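(* Let $(M,g)$ be a pseudo-Riemannian manifold with Levi-Civita connection $\nabla^g$. For any $1$-form $\eta$ on $M$, let $\xi$ be the $g$-dual vector field of $\eta$ (i.e. $\eta(X)=g(\xi,X)$) and let $\nabla^{\eta}$ be the affine connection $$\nabla^{\eta}_XY=\nabla^g_XY+\eta(X)Y+\eta(Y)X+g(X,Y)\xi .$$ Then the pair $(g,\nabla^{\eta})$ is a statistical structure on $M$, and $\nabla^{-\eta}$ is the dual connection of $\nabla^{\eta}$ with respect to $g$.
   Context: A statistical structure on a smooth manifold $M$ is a pair $(g,\nabla)$ where $g$ is a pseudo-Riemannian metric, $\nabla$ is a torsion-free affine connection, and $(\nabla_X g)(Y,Z)=(\nabla_Y g)(X,Z)$ for all $X,Y,Z\in\mathfrak{X}(M)$. The dual connection $\nabla^*$ of $\nabla$ with respect to $g$ is the affine connection determined by $X(g(Y,Z))=g(\nabla_XY,Z)+g(Y,\nabla^*_XZ)$ for all $X,Y,Z\in\mathfrak{X}(M)$. $\nabla^{-\eta}$ is the connection obtained from the displayed formula by replacing $\eta$ by $-\eta$ (and hence $\xi$ by $-\xi$). *)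

(* Defs.v *)
From HB Require Import structures.
From mathcomp Require Import all_boot all_order all_algebra.
From mathcomp Require Import ring.
From mathcomp Require Import all_classical all_reals all_analysis.
Import GRing.Theory Num.Theory numFieldNormedType.Exports.

Set Implicit Arguments.
Unset Strict Implicit.
Unset Printing Implicit Defensive.

Local Open Scope classical_set_scope.
Local Open Scope ring_scope.

Section SmoothOnOpen.
Context {R : realType} {n : nat}.
Implicit Types (U : set 'rV[R]_n) (f g : 'rV[R]_n -> R).

(* U is meant to be open; the values of f outside U are irrelevant
   (see Ck_on_eq) *)
Fixpoint Ck_on (k : nat) U f : Prop :=
  (forall x, U x -> {for x, continuous f}) /\
  if k is k'.+1 then
    forall i : 'I_n,
      (forall x, U x -> derivable f x (delta_mx 0 i)) /\
      Ck_on k' U ('D_(delta_mx 0 i) f)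
  else True.

Definition smooth_on U f := forall k, Ck_on k U f.

Lemma Ck_on_eq k U f g : open U -> (forall x, U x -> f x = g x) ->
  Ck_on k U f -> Ck_on k U g.
Proof.
move: f g => f0 g0 oU.
have nU x : U x -> nbhs x U by move=> Ux; exact: open_nbhs_nbhs.
have nfg f g x : (forall y, U y -> f y = g y :> R) -> U x ->
    \forall y \near x, f y = g y.
  by move=> fg Ux; apply: filterS (nU x Ux).
have cfg f g x : (forall y, U y -> f y = g y :> R) -> U x ->
    {for x, continuous f} -> {for x, continuous g}.
  move=> fg Ux cf P; rewrite -fg// => /cf fP.
  apply: (@filterS2 _ _ (nbhs_filter x) _ _ _ _ fP (nU x Ux)).
  by move=> y /= fPy Uy; rewrite -fg.
elim: k f0 g0 => [|k IH] f g fg /= [cf df].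
  by split=> // x Ux; exact: cfg (cf x Ux).
split=> [x Ux|i]; first exact: cfg (cf x Ux).
have [d1 d2] := df i; split=> [y Uy|].
  by apply: near_eq_derivable (d1 y Uy); exact: nfg.
by apply: IH d2 => y Uy; apply: near_eq_derive; exact: nfg.
Qed.

Lemma Ck_onW k U f : Ck_on k.+1 U f -> Ck_on k U f.
Proof.
elim: k f => [|k IH] f [cf df]; split=> // i.
by have [d1 d2] := df i; split=> //; apply: IH.
Qed.

Lemma Ck_on_cst k U (a : R) : open U -> Ck_on k U (cst a).
Proof.
move=> oU; have cc (b : R) x : U x ->
    {for x, continuous (cst b : 'rV[R]_n -> R)}
  by move=> _; exact: cst_continuous.
elim: k a => [|k IH] a /=; first by split=> // x; exact: cc.
split=> [x|i]; first exact: cc.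
split=> [x _|]; first exact: derivable_cst.
by apply: Ck_on_eq (IH 0) => // x _; rewrite derive_cst.
Qed.

Lemma Ck_onD k U f g : open U -> Ck_on k U f -> Ck_on k U g ->
  Ck_on k U (f + g).
Proof.
move=> oU; elim: k f g => [|k IH] f g /= [cf df] [cg dg].
  by split=> // x Ux; apply: continuousD; [exact: cf|exact: cg].
split=> [x Ux|i]; first by apply: continuousD; [exact: cf|exact: cg].
have [df1 df2] := df i; have [dg1 dg2] := dg i.
split=> [x Ux|]; first by apply: derivableD; [exact: df1|exact: dg1].
apply: Ck_on_eq (IH _ _ df2 dg2) => // x Ux.
by rewrite deriveD; [|exact: df1|exact: dg1].
Qed.

Lemma Ck_onM k U f g : open U -> Ck_on k U f -> Ck_on k U g ->
  Ck_on k U (f * g).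
Proof.
move=> oU; elim: k f g => [|k IH] f g Cf Cg;
  have [cf df] := Cf; have [cg dg] := Cg.
  by split=> // x Ux; apply: continuousM; [exact: cf|exact: cg].
split=> [x Ux|i]; first by apply: continuousM; [exact: cf|exact: cg].
have [df1 df2] := df i; have [dg1 dg2] := dg i.
split=> [x Ux|]; first by apply: derivableM; [exact: df1|exact: dg1].
have := Ck_onD oU (IH _ _ (Ck_onW Cf) dg2) (IH _ _ (Ck_onW Cg) df2).
apply: Ck_on_eq => // x Ux.
by rewrite deriveM; [|exact: df1|exact: dg1].
Qed.

End SmoothOnOpen.

Record chart (R : realType) (n : nat) (M : topologicalType) := Chart {
  chart_dom : set M;
  chart_fun :> M -> 'rV[R]_n;
  chart_inv : 'rV[R]_n -> M;
  chart_dom_open : open chart_dom;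
  chart_image_open : open (chart_fun @` chart_dom);
  chart_fun_continuous : {within chart_dom, continuous chart_fun};
  chart_inv_continuous :
    {within chart_fun @` chart_dom, continuous chart_inv};
  chart_funK : forall p, chart_dom p -> chart_inv (chart_fun p) = p }.

(* change of coordinates from c to d *)
Definition smoothly_compatible (R : realType) (n : nat) (M : topologicalType)
    (c d : chart R n M) :=
  forall i, smooth_on (c @` (chart_dom c `&` chart_dom d))
                      (fun x => d (chart_inv c x) 0 i).

(* The smooth structure is the one generated by the atlas, which is not
   required to be maximal. *)
Record smoothManifold (R : realType) (n : nat) := SmoothManifold {
  manifold_space :> topologicalType;
  manifold_hausdorff : hausdorff_space manifold_space;
  manifold_second_countable : @second_countable manifold_space;
  atlas : set (chart R n manifold_space);
  atlas_cover : forall p, exists2 c, atlas c & chart_dom c p;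
  atlas_compatible : forall c d, atlas c -> atlas d ->
    smoothly_compatible c d }.

Section SmoothFunctions.
Context {R : realType} {n : nat} (M : smoothManifold R n).

Definition smooth_fun : {pred M -> R} := fun f =>
  `[< forall c, @atlas R n M c ->
        smooth_on (c @` chart_dom c) (f \o chart_inv c) >].

Lemma smooth_funP f : reflect
  (forall c, @atlas R n M c ->
     smooth_on (c @` chart_dom c) (f \o chart_inv c))
  (f \in smooth_fun).
Proof. exact: asboolP. Qed.

Lemma smooth_fun_cst (a : R) : cst a \in smooth_fun.
Proof.
by apply/smooth_funP => c _ k; apply: Ck_on_cst; exact: chart_image_open.
Qed.

Lemma smooth_funD f g :
  f \in smooth_fun -> g \in smooth_fun -> f + g \in smooth_fun.
Proof.
move=> /smooth_funP Cf /smooth_funP Cg; apply/smooth_funP => c Ac k.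
exact: Ck_onD (@chart_image_open _ _ _ c) (Cf c Ac k) (Cg c Ac k).
Qed.

Lemma smooth_funM f g :
  f \in smooth_fun -> g \in smooth_fun -> f * g \in smooth_fun.
Proof.
move=> /smooth_funP Cf /smooth_funP Cg; apply/smooth_funP => c Ac k.
exact: Ck_onM (@chart_image_open _ _ _ c) (Cf c Ac k) (Cg c Ac k).
Qed.

Lemma smooth_funZ (a : R) f : f \in smooth_fun -> a *: f \in smooth_fun.
Proof. by move=> Cf; exact: smooth_funM (smooth_fun_cst a) Cf. Qed.

Lemma smooth_fun_subring_closed : subring_closed smooth_fun.
Proof.
split; [exact: smooth_fun_cst| |exact: smooth_funM].
by move=> f g Cf Cg; rewrite -[- g]scaleN1r smooth_funD// smooth_funZ.
Qed.
HB.instance Definition _ := GRing.isSubringClosed.Build (M -> R) smooth_fun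
  smooth_fun_subring_closed.

Lemma smooth_fun_scaler_closed : GRing.scaler_closed smooth_fun.
Proof. exact: smooth_funZ. Qed.
HB.instance Definition _ := GRing.isScaleClosed.Build R (M -> R) smooth_fun
  smooth_fun_scaler_closed.

Record smoothFun := SmoothFun {
  smoothFun_val :> M -> R;
  smoothFun_smooth : smoothFun_val \in smooth_fun }.
HB.instance Definition _ := [isSub for smoothFun_val].
HB.instance Definition _ := [Choice of smoothFun by <:].
HB.instance Definition _ := 
  GRing.SubChoice_isSubComPzRing.Build (M -> R) smooth_fun smoothFun
    smooth_fun_subring_closed.
HB.instance Definition _ := [SubZmodule_isSubLmodule of smoothFun by <:].

End SmoothFunctions.

Arguments smooth_fun {R n} M _.
Arguments smooth_fun_cst {R n} M a.

Notation "''C^oo' ( M )" := (smoothFun M) (at level 0, format "''C^oo' ( M )").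

(* A tangent vector at p is a derivation at p of the algebra C^oo(M). *)
Section TangentVectors.
Context {R : realType} {n : nat} {M : smoothManifold R n} (p : M).

Definition derivation_at : {pred 'C^oo(M) -> R} := fun v =>
  `[< scalar v /\ forall f h : 'C^oo(M), v (f * h) = f p * v h + h p * v f >].

Lemma derivation_atP v : reflect
  (scalar v /\ forall f h : 'C^oo(M), v (f * h) = f p * v h + h p * v f)
  (v \in derivation_at).
Proof. exact: asboolP. Qed.

Lemma derivation_at_submod_closed : GRing.submod_closed derivation_at.
Proof.
split; first by apply/derivation_atP; split=> [a f h|f h] /=;
  rewrite ?mulr0 ?addr0.
move=> a u v /derivation_atP[lu Lu] /derivation_atP[lv Lv].
apply/derivation_atP; split=> [b f h|f h]; rewrite !fctE.
  by rewrite lu lv /GRing.scale /=; ring.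
by rewrite Lu Lv /GRing.scale /=; ring.
Qed.
HB.instance Definition _ := GRing.isSubmodClosed.Build R ('C^oo(M) -> R)
  derivation_at derivation_at_submod_closed.

Record tangent := Tangent {
  tangent_val :> 'C^oo(M) -> R;
  tangent_derivation : tangent_val \in derivation_at }.
HB.instance Definition _ := [isSub for tangent_val].
HB.instance Definition _ := [Choice of tangent by <:].
HB.instance Definition _ := [SubChoice_isSubLmodule of tangent by <:].

Lemma tangent_scalar (v : tangent) : scalar v.
Proof. by have /derivation_atP[] := tangent_derivation v. Qed.

Lemma tangentM (v : tangent) (f h : 'C^oo(M)) :
  v (f * h) = f p * v h + h p * v f.
Proof. by have /derivation_atP[_] := tangent_derivation v; apply. Qed.

End TangentVectors.

Section VectorFields.
Context {R : realType} {n : nat} (M : smoothManifold R n).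

(* A section X of the tangent bundle is smooth iff X f is a smooth function
   for every f in C^oo(M). *)
Record vectorField := VectorField {
  vf_val :> forall p : M, tangent p;
  vf_smooth : forall f : 'C^oo(M), (fun p => vf_val p f) \in smooth_fun M }.

Lemma vf_ext (X Y : vectorField) : (forall p, X p = Y p) -> X = Y.
Proof.
case: X Y => [X sX] [Y sY] /= XY.
have {}XY : X = Y by exact: functional_extensionality_dep.
by case: _ / XY sY => sY; congr VectorField; exact: Prop_irrelevance.
Qed.

HB.instance Definition _ := gen_eqMixin vectorField.
HB.instance Definition _ := gen_choiceMixin vectorField.

Fact vf_zero_subproof (f : 'C^oo(M)) :
  (fun p => (0 : tangent p) f) \in smooth_fun M.
Proof. exact: (smooth_fun_cst M 0). Qed.
Definition vf_zero := VectorField vf_zero_subproof.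

Fact vf_opp_subproof (X : vectorField) (f : 'C^oo(M)) :
  (fun p => (- X p) f) \in smooth_fun M.
Proof. by have := smooth_funZ (-1) (vf_smooth X f); rewrite scaleN1r. Qed.
Definition vf_opp X := VectorField (vf_opp_subproof X).

Fact vf_add_subproof (X Y : vectorField) (f : 'C^oo(M)) :
  (fun p => (X p + Y p) f) \in smooth_fun M.
Proof. exact: smooth_funD (vf_smooth X f) (vf_smooth Y f). Qed.
Definition vf_add X Y := VectorField (vf_add_subproof X Y).

Fact vf_scale_subproof (a : 'C^oo(M)) (X : vectorField) (f : 'C^oo(M)) :
  (fun p => (a p *: X p) f) \in smooth_fun M.
Proof. exact: smooth_funM (smoothFun_smooth a) (vf_smooth X f). Qed.
Definition vf_scale a X := VectorField (vf_scale_subproof a X).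

Fact vf_addA : associative vf_add.
Proof. by move=> X Y Z; apply: vf_ext => p; exact: addrA. Qed.
Fact vf_addC : commutative vf_add.
Proof. by move=> X Y; apply: vf_ext => p; exact: addrC. Qed.
Fact vf_add0 : left_id vf_zero vf_add.
Proof. by move=> X; apply: vf_ext => p; exact: add0r. Qed.
Fact vf_addN : left_inverse vf_zero vf_opp vf_add.
Proof. by move=> X; apply: vf_ext => p; exact: addNr. Qed.
HB.instance Definition _ :=
  GRing.isZmodule.Build vectorField vf_addA vf_addC vf_add0 vf_addN.

Fact vf_scaleA a b (X : vectorField) :
  vf_scale a (vf_scale b X) = vf_scale (a * b) X.
Proof. by apply: vf_ext => p; exact: scalerA. Qed.
Fact vf_scale1 : left_id 1 vf_scale.
Proof. by move=> X; apply: vf_ext => p; exact: scale1r. Qed.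
Fact vf_scaleDr : right_distributive vf_scale +%R.
Proof. by move=> a X Y; apply: vf_ext => p; exact: scalerDr. Qed.
Fact vf_scaleDl X : {morph vf_scale^~ X : a b / a + b}.
Proof. by move=> a b; apply: vf_ext => p; exact: scalerDl. Qed.
HB.instance Definition _ := GRing.Zmodule_isLmodule.Build
  'C^oo(M) vectorField vf_scaleA vf_scale1 vf_scaleDr vf_scaleDl.

Definition vf_apply (X : vectorField) (f : 'C^oo(M)) : 'C^oo(M) :=
  SmoothFun (vf_smooth X f).

Lemma vf_apply_linear X : linear (vf_apply X).
Proof.
move=> a f h; apply: val_inj; apply/funext => p /=.
exact: tangent_scalar.
Qed.

Lemma vf_applyM X (f h : 'C^oo(M)) :
  vf_apply X (f * h) = f * vf_apply X h + h * vf_apply X f.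
Proof. by apply: val_inj; apply/funext => p /=; exact: tangentM. Qed.

Fact lie_bracket_derivation (X Y : vectorField) (p : M) :
  (fun f => X p (vf_apply Y f) - Y p (vf_apply X f)) \in derivation_at p.
Proof.
apply/derivation_atP; split=> [a f h|f h] /=.
  by rewrite !vf_apply_linear !tangent_scalar /GRing.scale /=; ring.
have tD (v : tangent p) (f1 f2 : 'C^oo(M)) : v (f1 + f2) = v f1 + v f2.
  by have := tangent_scalar v 1 f1 f2; rewrite scale1r /GRing.scale /= mul1r.
by rewrite !vf_applyM !tD !tangentM /=; ring.
Qed.

Definition lie_bracket_at (X Y : vectorField) (p : M) : tangent p :=
  Tangent (lie_bracket_derivation X Y p).

Fact lie_bracket_smooth (X Y : vectorField) (f : 'C^oo(M)) :
  (fun p => lie_bracket_at X Y p f) \in smooth_fun M.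
Proof.
have := rpredB (vf_smooth X (vf_apply Y f)) (vf_smooth Y (vf_apply X f)).
by [].
Qed.

Definition lie_bracket X Y := VectorField (lie_bracket_smooth X Y).

End VectorFields.

Section TensorFields.
Context {R : realType} {n : nat} (M : smoothManifold R n).

(* A covariant tensor field is smooth iff its values on smooth vector fields
   are smooth functions. *)
Record oneForm := OneForm {
  form_val :> forall p : M, {scalar tangent p};
  form_smooth : forall X : vectorField M,
    (fun p => form_val p (X p)) \in smooth_fun M }.

(* Nondegeneracy makes the index of the metric locally constant; it is not
   required to agree on different connected components. *)
Record pseudoRiemannianMetric := PseudoRiemannianMetric {
  prm_val :> forall p : M, {biscalar tangent p};
  prm_sym : forall p (v w : tangent p), prm_val p v w = prm_val p w v;
  prm_nondegenerate : forall p (v : tangent p),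
    (forall w, prm_val p v w = 0) -> v = 0;
  prm_smooth : forall X Y : vectorField M,
    (fun p => prm_val p (X p) (Y p)) \in smooth_fun M }.

Implicit Types (eta : oneForm) (g : pseudoRiemannianMetric).

Definition form_apply eta (X : vectorField M) : 'C^oo(M) :=
  SmoothFun (form_smooth eta X).

Definition metric_apply g (X Y : vectorField M) : 'C^oo(M) :=
  SmoothFun (prm_smooth g X Y).

Fact form_opp_smooth eta (X : vectorField M) :
  (fun p => (\- eta p : {scalar tangent p}) (X p)) \in smooth_fun M.
Proof. by have := smooth_funZ (-1) (form_smooth eta X); rewrite scaleN1r. Qed.

Definition form_opp eta : oneForm := OneForm (form_opp_smooth eta).

(* xi is the g-dual vector field of eta *)
Definition metric_dual g eta (xi : vectorField M) :=
  forall X, form_apply eta X = metric_apply g xi X.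

End TensorFields.

Section Connections.
Context {R : realType} {n : nat} {M : smoothManifold R n}.
Implicit Types (nabla : vectorField M -> vectorField M -> vectorField M).
Implicit Types (g : pseudoRiemannianMetric M) (eta : oneForm M).
Implicit Types (a : 'C^oo(M)) (X Y Z xi : vectorField M).

(* nabla X Y is the covariant derivative of Y along X; homogeneity over the
   constants in Y follows from the Leibniz rule *)
Definition affine_connection nabla :=
  [/\ forall Y, linear (nabla^~ Y),
      forall X Y Z, nabla X (Y + Z) = nabla X Y + nabla X Z &
      forall X a Y, nabla X (a *: Y) = vf_apply X a *: Y + a *: nabla X Y].

Definition torsion_free nabla :=
  forall X Y, nabla X Y - nabla Y X = lie_bracket X Y.

(* (nabla_X g)(Y, Z) *)
Definition metric_derivative g nabla X Y Z : 'C^oo(M) :=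
  vf_apply X (metric_apply g Y Z)
  - metric_apply g (nabla X Y) Z - metric_apply g Y (nabla X Z).

Definition levi_civita g nabla :=
  [/\ affine_connection nabla, torsion_free nabla &
      forall X Y Z, metric_derivative g nabla X Y Z = 0].

Definition statistical_structure g nabla :=
  [/\ affine_connection nabla, torsion_free nabla &
      forall X Y Z,
        metric_derivative g nabla X Y Z = metric_derivative g nabla Y X Z].

Definition dual_connection g nabla nabla' :=
  affine_connection nabla' /\
  forall X Y Z, vf_apply X (metric_apply g Y Z) =
    metric_apply g (nabla X Y) Z + metric_apply g Y (nabla' X Z).

(* nabla is meant to be the Levi-Civita connection of g, and xi the g-dual of
   eta *)
Definition eta_connection g nabla eta xi X Y : vectorField M :=
  nabla X Y + form_apply eta X *: Y + form_apply eta Y *: X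
  + metric_apply g X Y *: xi.

End Connections.

(* Main.v *)
Require Import Defs.
From mathcomp Require Import all_boot all_order all_algebra.
From mathcomp Require Import ring.
From mathcomp Require Import all_classical all_reals all_analysis.
Import GRing.Theory.
Local Open Scope ring_scope.

Section EtaConnection.
Context {R : realType} {n : nat} {M : smoothManifold R n}.
Implicit Types (g : pseudoRiemannianMetric M) (eta : oneForm M).
Implicit Types (a : 'C^oo(M)) (X Y Z xi : vectorField M).
Implicit Types (nabla : vectorField M -> vectorField M -> vectorField M).

(** Put C(X,Y,Z) = eta(X) g(Y,Z) + eta(Y) g(X,Z) + eta(Z) g(X,Y). The terms added to the Levi-Civita
    connection form a tensor symmetric in X and Y, so the result is again affine and torsion-free;
    lowering its index with g gives C ([metric_apply_eta_connection]). Since g is parallel for the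
    Levi-Civita connection, its derivative becomes -2C ([metric_derivative_eta_connection]), and the
    symmetry of C is the Codazzi equation. Replacing eta by -eta turns C into -C, so the two
    corrections cancel in the duality identity. *)

Lemma form_apply_linear eta a X Y :
  form_apply eta (a *: X + Y) = a * form_apply eta X + form_apply eta Y.
Proof.
by apply: val_inj; apply/funext => p; exact: (linearP (eta p) (a p) (X p)).
Qed.

Lemma form_applyD eta X Y :
  form_apply eta (X + Y) = form_apply eta X + form_apply eta Y.
Proof. by have := form_apply_linear eta 1 X Y; rewrite scale1r mul1r. Qed.

Lemma form_applyZ eta a X : form_apply eta (a *: X) = a * form_apply eta X.
Proof.
by apply: val_inj; apply/funext => p; exact: (linearZ_LR (eta p) (a p) (X p)).
Qed.

Lemma form_apply_opp eta X : form_apply (form_opp eta) X = - form_apply eta X.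
Proof. exact: val_inj. Qed.

Lemma metric_applyC g X Y : metric_apply g X Y = metric_apply g Y X.
Proof. by apply: val_inj; apply/funext => p; exact: prm_sym. Qed.

Lemma metric_apply_linearl g a X Y Z :
  metric_apply g (a *: X + Y) Z = a * metric_apply g X Z + metric_apply g Y Z.
Proof.
apply: val_inj; apply/funext => p.
exact: (linearPl (g p) (Z p) (a p) (X p) (Y p)).
Qed.

Lemma metric_applyDl g X Y Z :
  metric_apply g (X + Y) Z = metric_apply g X Z + metric_apply g Y Z.
Proof. by have := metric_apply_linearl g 1 X Y Z; rewrite scale1r mul1r. Qed.

Lemma metric_applyZl g a X Z :
  metric_apply g (a *: X) Z = a * metric_apply g X Z.
Proof.
apply: val_inj; apply/funext => p.
exact: (linearZl_LR (g p) (Z p) (a p) (X p)).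
Qed.

Lemma metric_applyNl g X Z : metric_apply g (- X) Z = - metric_apply g X Z.
Proof. by rewrite -scaleN1r metric_applyZl mulN1r. Qed.

(** The added terms are bilinear over ['C^oo(M)], so the Leibniz term comes from [nabla] alone. *)
Lemma eta_connection_affine g nabla eta xi :
  affine_connection nabla -> affine_connection (eta_connection g nabla eta xi).
Proof.
case=> nablaP nablaD nablaZ; split.
- move=> Y a X X'; rewrite /eta_connection nablaP form_apply_linear.
  rewrite metric_apply_linearl !scalerDl !scalerDr !scalerA.
  rewrite [form_apply eta Y * a]mulrC.
  (* Each of the four summands has split in two; the odd positions collect the multiples of [a]. *)
  by rewrite [LHS](AC (((2*2)*2)*2) ((1*3*5*7)*(2*4*6*8))).
- move=> X Y Z; rewrite /eta_connection nablaD form_applyD.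
  rewrite metric_applyC metric_applyDl ![metric_apply g _ X]metric_applyC.
  rewrite !scalerDl !scalerDr.
  by rewrite [LHS](AC (((2*2)*2)*2) ((1*3*5*7)*(2*4*6*8))).
- move=> X a Y; rewrite /eta_connection nablaZ form_applyZ.
  rewrite metric_applyC metric_applyZl [metric_apply g Y X]metric_applyC.
  by rewrite !scalerDr !scalerA [form_apply eta X * a]mulrC !addrA.
Qed.

Lemma eta_connection_torsion_free g nabla eta xi :
  torsion_free nabla -> torsion_free (eta_connection g nabla eta xi).
Proof.
move=> tf X Y; rewrite -tf /eta_connection [metric_apply g Y X]metric_applyC.
(* Swapping the two eta terms aligns both sums, so the three added terms cancel pairwise. *)
rewrite [nabla Y X + _ + _]addrAC.
by do 3!rewrite opprD addrACA subrr addr0.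
Qed.

(* The correction term is totally symmetric in X, Y, Z, whence the Codazzi
   equation, and odd in eta, whence the duality. *)
Lemma metric_apply_eta_connection g nabla eta xi X Y Z :
  metric_dual g eta xi ->
  metric_apply g (eta_connection g nabla eta xi X Y) Z =
  metric_apply g (nabla X Y) Z + (form_apply eta X * metric_apply g Y Z
    + form_apply eta Y * metric_apply g X Z
    + form_apply eta Z * metric_apply g X Y).
Proof.
move=> dual; rewrite /eta_connection !metric_applyDl !metric_applyZl -dual.
by rewrite [metric_apply g X Y * _]mulrC !addrA.
Qed.

Lemma metric_dual_opp g eta xi :
  metric_dual g eta xi -> metric_dual g (form_opp eta) (- xi).
Proof. by move=> dual X; rewrite form_apply_opp dual metric_applyNl. Qed.

(** The cubic form is subtracted twice: once from differentiating Y, once from differentiating Z. *)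
Lemma metric_derivative_eta_connection g nabla eta xi X Y Z :
  metric_dual g eta xi ->
  metric_derivative g (eta_connection g nabla eta xi) X Y Z =
  metric_derivative g nabla X Y Z
  - (form_apply eta X * metric_apply g Y Z
    + form_apply eta Y * metric_apply g X Z
    + form_apply eta Z * metric_apply g X Y) *+ 2.
Proof.
move=> dual; rewrite /metric_derivative [metric_apply g Y (_ X Z)]metric_applyC.
rewrite !metric_apply_eta_connection// [metric_apply g (nabla X Z) Y]metric_applyC.
rewrite [metric_apply g Z Y]metric_applyC.
ring.
Qed.

End EtaConnection.

Theorem proposition3p1 (R : realType) (n : nat) (M : smoothManifold R n)
  (g : pseudoRiemannianMetric M)
  (nabla_g : vectorField M -> vectorField M -> vectorField M)
  (nabla_g_LC : levi_civita g nabla_g)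
  (eta : oneForm M) (xi : vectorField M) (xi_dual : metric_dual g eta xi) :
  statistical_structure g (eta_connection g nabla_g eta xi) /\
  dual_connection g (eta_connection g nabla_g eta xi)
    (eta_connection g nabla_g (form_opp eta) (- xi)).
Proof.
have [affine_g tf_g parallel_g] := nabla_g_LC.
split; split.
- exact: eta_connection_affine.
- exact: eta_connection_torsion_free.
- move=> X Y Z; rewrite !metric_derivative_eta_connection// !parallel_g.
  rewrite [metric_apply g Y X]metric_applyC.
  ring.
- exact: eta_connection_affine.
- move=> X Y Z; have /eqP := parallel_g X Y Z.
  (* Parallelism of g, read as the product rule for g(Y,Z). *)
  rewrite /metric_derivative -addrA -opprD subr_eq0 => /eqP ->.
  (* Symmetry of g moves the second connection into the first slot, where its correction is -C. *)
  rewrite [in RHS](metric_applyC g Y) !metric_apply_eta_connection//; last first.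
    exact: metric_dual_opp.
  rewrite !form_apply_opp [metric_apply g Z Y]metric_applyC.
  rewrite [metric_apply g (nabla_g X Z) Y]metric_applyC.
  ring.
Qed.
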